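(* Let $M>1$ be an integer with $M\equiv 3,5,6,7,8$ or $10 \pmod{12}$. Then the sum of the squares of $M$ consecutive integers cannot be an integer square; that is, there are no integers $a,s$ with $\sum_{i=0}^{M-1}(a+i)^2=s^2$. *)

(* Defs.v *)
From mathcomp Require Export all_boot all_order all_algebra.

(* Main.v *)
Require Import Defs.
From mathcomp Require Import all_boot all_order all_algebra.
From mathcomp Require Import zify ring.
Import GRing.Theory.
Local Open Scope ring_scope.

(** Completing the square turns 12 times the sum into M * N with
    N = 3 b ^ 2 + M ^ 2 - 1 and b = 2 a + M - 1 (lemma [sum_sqr]), so a square
    sum s ^ 2 would give M * N = 12 * s ^ 2.  For each residue of M mod 12 the
    factor 12 (or 12 times 4) can be distributed as a constant c dividing M and
    a constant d dividing N, so that x = M / c and y = N / d satisfy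
    x * y = a square.  Then x = g e ^ 2 and y = g f ^ 2 with g = gcd(x, y).

    The residue of g is restricted: g divides M and N, hence 3 b ^ 2 - 1, so 3
    is a square mod g.  When g is odd this forces g = 1 or -1 mod 12.  That is
    the Jacobi symbol of 3 when g is prime, but it is proved here for every
    odd g at once, with neither quadratic reciprocity nor factorization: Thue's
    pigeonhole argument gives small x, y, not both 0, with x ^ 2 - 3 y ^ 2 a
    multiple of g, and the size bounds leave only the multiples -g and -2g,
    which are decided by congruences ([modulus_mod12_of_3_sqr]).

    Consequently x and y are, mod 12, both squares or both opposites of
    squares: both in {0, 1, 4, 9} or both in {0, 3, 8, 11}
    ([complementary_factors_mod12]).  In each of the six classes of M, the
    residues of x and y violate this. *)

(** * Squares modulo 24 and 12 *)

Lemma sqr_mod24 (x : nat) : (x ^ 2 %% 24 \in [:: 0; 1; 4; 9; 12; 16])%N.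
Proof.
rewrite -modnXm; have: (x %% 24 < 24)%N by rewrite ltn_mod.
by move: (x %% 24)%N => r; do 24 (case: r => [|r] //).
Qed.

Lemma sqr_mod12 (x : nat) : (x ^ 2 %% 12 \in [:: 0; 1; 4; 9])%N.
Proof.
have := sqr_mod24 x; rewrite -(@modn_dvdm 24 _ 12) // !inE.
by move: (x ^ 2 %% 24)%N => r /orP[|/orP[|/or4P[]]] /eqP->.
Qed.

(** Squaring gains a factor 2 of precision: (r + 12 q) ^ 2 - r ^ 2 is a multiple
    of 24. *)
Lemma sqr_mod24_mod12 (x : nat) : (x ^ 2 = (x %% 12) ^ 2 %[mod 24])%N.
Proof.
have {1}-> := divn_eq x 12; set q := (x %/ 12)%N; set r := (x %% 12)%N.
have -> : ((q * 12 + r) ^ 2 = (6 * q ^ 2 + q * r) * 24 + r ^ 2)%N by lia.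
by rewrite modnMDl.
Qed.

(** * Moduli for which 3 is a square *)

Lemma sqr_absz (x : int) : x ^+ 2 = (`|x| ^ 2)%N%:Z.
Proof. by rewrite -abszX gez0_abs // Num.Theory.sqr_ge0. Qed.

(** Irrationality of the square root of 3: the 3-adic valuations of the two
    sides have different parities when y is not 0. *)
Lemma sqr_eq3sqr (x y : nat) : (x ^ 2 = 3 * y ^ 2)%N -> y = 0%N.
Proof.
case: y => [//|y] E; have x_gt0: (0 < x)%N by case: x E => // E; lia.
have := congr1 (logn 3) E.
by rewrite lognM // !lognX (@logn_prime 3 3) //; lia.
Qed.

Lemma nat_sqrt (n : nat) : exists k, (k ^ 2 <= n < k.+1 ^ 2)%N.
Proof.
elim: n => [|n [k /andP[lb ub]]]; first by exists 0%N.
case: (ltnP n.+1 (k.+1 ^ 2)) => h; first by exists k; lia.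
by exists k.+1; lia.
Qed.

(** Thue's lemma.  With k the integer part of the square root of n, the
    (k + 1) ^ 2 > n values u + r v for 0 <= u, v <= k cannot be distinct mod n;
    two that collide differ by the required pair.  That n is not a square makes
    the bounds strict. *)
Lemma thue (n r : nat) : (forall k, n <> k ^ 2)%N ->
  exists x y : int, [/\ (x != 0) || (y != 0), (n %| x - r%:Z * y)%Z,
    x ^+ 2 < n%:Z & y ^+ 2 < n%:Z].
Proof.
move=> nsq; have [k /andP[lb ub]] := nat_sqrt n.
have lb' : (k ^ 2 < n)%N by have := nsq k; lia.
case: n nsq lb ub lb' => [//|n] nsq lb ub lb'.
pose f (p : 'I_k.+1 * 'I_k.+1) : 'I_n.+1 := inord ((p.1 + r * p.2) %% n.+1).
have /injectivePn[[u v] [[u' v'] neq E]] : ~~ injectiveb f.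
  apply/negP => /injectiveP /leq_card.
  by rewrite card_prod !card_ord; lia.
have {}E : (u + r * v = u' + r * v' %[mod n.+1])%N.
  by move/(congr1 val): E; rewrite /f /= !inordK ?ltn_mod.
have bnd (a b : 'I_k.+1) : (a%:Z - b%:Z) ^+ 2 < n.+1%:Z.
  have := ltn_ord a; have := ltn_ord b; move: (val a) (val b) => /= p q hp hq.
  by nia.
exists (u%:Z - u'%:Z), (v'%:Z - v%:Z); split => //.
- apply: contraR neq; rewrite negb_or !negbK !subr_eq0 => /andP[/eqP[eu] /eqP[ev]].
  by apply/eqP; congr (_, _); apply: val_inj.
- have -> : u%:Z - u'%:Z - r%:Z * (v'%:Z - v%:Z)
          = (u + r * v)%N%:Z - (u' + r * v')%N%:Z :> int by lia.
  by rewrite -eqz_mod_dvd !modz_nat E.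
Qed.

(** The size bounds give -3 g < X - 3 Y < g, and X - 3 Y is not 0, so X + g = 3 Y
    or X + 2 g = 3 Y.  As X and Y have residues of squares, the first equation
    forces g = 11 and the second g = 1 mod 12; the second needs the residues
    mod 24 because of the factor 2. *)
Lemma norm_multiple_mod12 (g X Y : nat) (q : int) :
  odd g -> (g %% 3 != 0)%N ->
  (X %% 24 \in [:: 0; 1; 4; 9; 12; 16])%N ->
  (Y %% 24 \in [:: 0; 1; 4; 9; 12; 16])%N ->
  X%:Z < g%:Z -> Y%:Z < g%:Z -> X <> (3 * Y)%N ->
  X%:Z - 3 * Y%:Z = q * g%:Z -> (g %% 12 \in [:: 1; 11])%N.
Proof.
move=> g_odd g3 hX hY ltX ltY neq Eq.
have g_gt0 : 0 < g%:Z :> int by lia.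
have q_lt1 : q < 1.
  by rewrite -(Num.Theory.ltr_pM2r g_gt0) -Eq; clear - ltX ltY; lia.
have q_gt : -3 < q.
  by rewrite -(Num.Theory.ltr_pM2r g_gt0) -Eq; clear - ltX ltY; lia.
have : q = -1 \/ q = -2 \/ q = 0 by clear - q_lt1 q_gt; lia.
case=> [q1|[q2|q0]]; last by rewrite q0 in Eq; lia.
  have {}Eq : (X + g = 3 * Y)%N by rewrite q1 in Eq; clear - Eq; lia.
  by clear - g_odd g3 hX hY Eq; move: hX hY; rewrite !inE; lia.
have {}Eq : (X + 2 * g = 3 * Y)%N by rewrite q2 in Eq; clear - Eq; lia.
by clear - g_odd g3 hX hY Eq; move: hX hY; rewrite !inE; lia.
Qed.

(** The hypothesis says that 3 B is a square root of 3 mod g.  Thue's lemma for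
    r = 3 B gives x = r y mod g, hence x ^ 2 = 3 y ^ 2 mod g with x ^ 2 and
    y ^ 2 less than g. *)
Lemma modulus_mod12_of_3_sqr (g B : nat) : odd g -> (3 * B ^ 2 = 1 %[mod g])%N ->
  (g %% 12 \in [:: 1; 11])%N.
Proof.
move=> g_odd hB.
have g3 : (g %% 3 != 0)%N.
  apply/negP => /eqP h3; have d3 : (3 %| g)%N by rewrite /dvdn h3.
  have := congr1 (modn^~ 3) hB; rewrite /= !modn_dvdm // mulnC.
  by rewrite modnMl.
(* A square g is excluded from Thue's lemma, but an odd square prime to 3 is
   1 mod 12. *)
have [k /andP[lb ub]] := nat_sqrt g.
have [gk|gk] := eqVneq g (k ^ 2)%N.
  by have := sqr_mod12 k; rewrite -gk !inE; clear - g_odd g3; lia.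
have nsq j : g <> (j ^ 2)%N.
  move=> gj; have : (k < j < k.+1)%N; last lia.
  rewrite -(ltn_exp2r k j (isT : 0 < 2)%N).
  by rewrite -(ltn_exp2r j k.+1 (isT : 0 < 2)%N) -gj; lia.
have [x [y [nz dv bx by_]]] := thue g (3 * B) nsq.
have [q Eq] : exists q : int, x ^+ 2 - 3 * y ^+ 2 = q * g%:Z.
  have d1 : (g %| (3 * B ^ 2)%N%:Z - 1)%Z.
    by rewrite -eqz_mod_dvd !modz_nat hB.
  case/dvdzP: d1 => q1 E1; case/dvdzP: dv => q2 E2.
  (* x ^ 2 - 3 y ^ 2 = (x - r y) (x + r y) + (r ^ 2 - 3) y ^ 2 with r = 3 B. *)
  exists (q2 * (x + (3 * B)%N%:Z * y) + 3 * q1 * y ^+ 2).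
  have -> : (q2 * (x + (3 * B)%N%:Z * y) + 3 * q1 * y ^+ 2) * g%:Z =
    (q2 * g%:Z) * (x + (3 * B)%N%:Z * y) + 3 * y ^+ 2 * (q1 * g%:Z) by ring.
  by rewrite -E1 -E2 !PoszM; ring.
rewrite !sqr_absz in bx by_ Eq.
have hx := sqr_mod24 `|x|%N; have hy := sqr_mod24 `|y|%N.
have irr : (`|x| ^ 2)%N <> (3 * `|y| ^ 2)%N.
  move=> E3; have y0 := sqr_eq3sqr _ _ E3.
  move: E3 nz; rewrite -!absz_eq0 y0 => /eqP; rewrite expn_eq0 andbT => /eqP->.
  by [].
move: (`|x| ^ 2)%N (`|y| ^ 2)%N bx by_ hx hy irr Eq => X Y bx by_ hx hy irr Eq.
exact: norm_multiple_mod12 Eq.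
Qed.

(** * Factors of a square *)

(** gcd(x, z) ^ 2 = gcd(x ^ 2, x z, z ^ 2) with z ^ 2 = x y; taking out x leaves
    x * gcd(x, z, y), and the last factor is 1. *)
Lemma coprime_mul_eq_sqr (x y z : nat) : coprime x y -> (x * y = z ^ 2)%N ->
  x = (gcdn x z ^ 2)%N.
Proof.
move=> co E; rewrite -mulnn muln_gcdl !muln_gcdr mulnn.
rewrite -[(z * z)%N]/(z ^ 2)%N -E (mulnC z) -mulnn -!muln_gcdr.
rewrite (gcdnC z y) gcdnACA gcdnn (eqP co).
by rewrite gcd1n muln1.
Qed.

Lemma mul_eq_sqr (x y z : nat) : (0 < x)%N -> (x * y = z ^ 2)%N ->
  exists e f, x = (gcdn x y * e ^ 2)%N /\ y = (gcdn x y * f ^ 2)%N.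
Proof.
move=> x_gt0; set g := gcdn x y.
have g_gt0 : (0 < g)%N by rewrite gcdn_gt0 x_gt0.
have /dvdnP[u xE] : (g %| x)%N by rewrite dvdn_gcdl.
have /dvdnP[v yE] : (g %| y)%N by rewrite dvdn_gcdr.
have co : coprime u v.
  by rewrite /coprime -(eqn_pmul2r g_gt0) muln_gcdl -xE -yE mul1n.
rewrite xE yE => E.
have /dvdnP[w zE] : (g %| z)%N.
  by rewrite -(@dvdn_pexp2r _ _ 2) // -E mulnACA mulnn dvdn_mull.
have {}E : (u * v = w ^ 2)%N.
  apply/eqP; rewrite -(@eqn_pmul2r (g * g)) ?muln_gt0 ?g_gt0 //.
  by rewrite -mulnACA E zE expnMn mulnn.
exists (gcdn u w), (gcdn v w); split; rewrite mulnC.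
  by rewrite -(coprime_mul_eq_sqr _ _ _ co E).
by rewrite -(@coprime_mul_eq_sqr v u) // 1?coprime_sym // mulnC.
Qed.

(** Writing x = g e ^ 2 and y = g f ^ 2, the residue g = 1 or 11 gives x and y a
    common sign: the two lists are the squares mod 12 and their opposites. *)
Lemma factors_mod12 (x y z B : nat) : (0 < x)%N -> (x * y = z ^ 2)%N ->
    odd (gcdn x y) -> (3 * B ^ 2 = 1 %[mod gcdn x y])%N ->
  all (mem [:: 0; 1; 4; 9]) [:: x %% 12; y %% 12]%N
  \/ all (mem [:: 0; 3; 8; 11]) [:: x %% 12; y %% 12]%N.
Proof.
move=> x_gt0 E g_odd hB.
have := modulus_mod12_of_3_sqr _ _ g_odd hB.
have [e [f []]] := mul_eq_sqr _ _ _ x_gt0 E.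
move: (gcdn x y) => g -> ->.
rewrite -(modnMm _ (e ^ 2)) -(modnMm _ (f ^ 2)) /=.
move: (sqr_mod12 e) (sqr_mod12 f); rewrite !inE.
move: (g %% 12)%N (e ^ 2 %% 12)%N (f ^ 2 %% 12)%N => {}g p q hp hq.
case/orP=> /eqP->; [left|right];
by move: hp hq => /or4P[] /eqP-> /or4P[] /eqP->.
Qed.

(** * Sums of consecutive squares *)

Lemma sum_sqr (M : nat) (a : int) :
  12 * \sum_(i < M) (a + i%:Z) ^+ 2 =
  M%:Z * (3 * (2 * a + M%:Z - 1) ^+ 2 + M%:Z ^+ 2 - 1).
Proof.
elim: M => [|M IH]; first by rewrite big_ord0; ring.
by rewrite big_ord_recr /= mulrDr IH intS; ring.
Qed.

(** Here g = gcd(x, y) divides M and 3 B ^ 2 + M ^ 2 - 1, hence 3 B ^ 2 - 1, which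
    makes the previous restriction on g available; one of x, y being odd makes
    g odd. *)
Lemma complementary_factors_mod12 (M B x y z : nat) :
  (0 < M)%N -> (x * y = z ^ 2)%N -> (x %| M)%N -> (y %| 3 * B ^ 2 + M ^ 2 - 1)%N ->
  odd x || odd y ->
  all (mem [:: 0; 1; 4; 9]) [:: x %% 12; y %% 12]%N
  \/ all (mem [:: 0; 3; 8; 11]) [:: x %% 12; y %% 12]%N.
Proof.
move=> M_gt0 E dx dy xy_odd.
apply: (factors_mod12 x y z B) => //.
- exact: dvdn_gt0 M_gt0 dx.
- by case/orP: xy_odd; apply: dvdn_odd; rewrite ?dvdn_gcdl ?dvdn_gcdr.
have gM := dvdn_trans (dvdn_gcdl x y) dx.
have gN := dvdn_trans (dvdn_gcdr x y) dy.
have M2_gt0 : (0 < M ^ 2)%N by rewrite expn_gt0 M_gt0.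
have M2_0 : (M ^ 2 %% gcdn x y = 0)%N by apply/eqP; exact: dvdn_exp.
have /dvdnP[l Nl] := gN.
rewrite -(modnMDl l 1) -Nl subnK ?addn_gt0 ?M2_gt0 ?orbT //.
by rewrite -modnDmr M2_0 addn0.
Qed.

(** For even B, 3 B ^ 2 is 0 mod 12; for odd B, it is 3 mod 24.  Since b = 2 a + M - 1
    and M have opposite parities, M mod 12 determines the cofactor of M. *)
Lemma cofactor_mod24 (M B : nat) : (0 < M)%N -> odd B = ~~ odd M ->
  if odd M then (3 * B ^ 2 + M ^ 2 - 1 = (M %% 12) ^ 2 - 1 %[mod 12])%N
  else (3 * B ^ 2 + M ^ 2 - 1 = (M %% 12) ^ 2 + 2 %[mod 24])%N.
Proof.
move=> M_gt0.
have M2_gt0 : (0 < M ^ 2)%N by rewrite expn_gt0 M_gt0.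
have r2_gt0 : odd M -> (0 < (M %% 12) ^ 2)%N.
  by rewrite expn_gt0 orbF => M_odd; clear - M_odd; lia.
have := sqr_mod24_mod12 M; have := sqr_mod24 B.
have : odd (B ^ 2) = odd B by rewrite oddX.
move: (B ^ 2)%N (M ^ 2)%N M2_gt0 ((M %% 12) ^ 2)%N r2_gt0 => B2 M2 M2_gt0 r2 r2_gt0.
move=> <- hB hM par; move: r2_gt0 hB; rewrite !inE; case: (odd M) par => /= par r2_gt0;
  clear - M2_gt0 r2_gt0 par hM.
  by have {}r2_gt0 := r2_gt0 isT; lia.
by clear r2_gt0; lia.
Qed.

Theorem theorem2 (M : nat) (hM : (1 < M)%N)
    (hmod : (M %% 12)%N \in [:: 3; 5; 6; 7; 8; 10]%N) :
  ~ exists a s : int, \sum_(i < M) (a + i%:Z) ^+ 2 = s ^+ 2.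
Proof.
case=> a [s sum_s].
have := sum_sqr M a; rewrite sum_s.
set b := 2 * a + M%:Z - 1.
rewrite !sqr_absz.
have parB : odd `|b|%N = ~~ odd M by rewrite /b; clear; lia.
move: `|b|%N `|s|%N parB => {s sum_s b} B S parB E.
have M_gt0 : (0 < M)%N := ltnW hM.
have hN := cofactor_mod24 M B M_gt0 parB.
have lists x y z := @complementary_factors_mod12 M B x y z M_gt0.
have {}E : (M * (3 * B ^ 2 + M ^ 2 - 1) = 12 * S ^ 2)%N.
  apply/eqP; rewrite -eqz_nat !PoszM E; apply/eqP; congr (_ * _).
  have M2_gt0 : (0 < M ^ 2)%N by rewrite expn_gt0 M_gt0.
  by clear - M2_gt0; lia.
move: (3 * B ^ 2 + M ^ 2 - 1)%N E hN lists => N E hN lists.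
have M_parity : odd M = odd (M %% 12) by clear; lia.
rewrite M_parity in hN.
move: hmod; rewrite !inE; case/or4P=> [/eqP h|/eqP h|/eqP h|];
  [rewrite h /= in hN..|].
(* M = 3 mod 12: m = 1 mod 4 rules out the opposites of squares, and n = 2 mod 3
   rules out the squares. *)
- have [m Mm] : exists m, M = (3 * m)%N by exists (M %/ 3)%N; clear - h; lia.
  have [n Nn] : exists n, N = (4 * n)%N by exists (N %/ 4)%N; clear - hN; lia.
  have mn : (m * n = S ^ 2)%N by rewrite Mm Nn in E; clear - E; lia.
  have := lists m n S mn; rewrite Mm Nn !dvdn_mull //= !inE; lia.
(* M = 5 mod 12 is in neither list. *)
- have [n Nn] : exists n, N = (12 * n)%N by exists (N %/ 12)%N; clear - hN; lia.
  have mn : (M * n = S ^ 2)%N by rewrite Nn in E; clear - E; lia.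
  have := lists M n S mn; rewrite Nn dvdn_mull //= !inE dvdnn; lia.
(* M = 6 mod 12: n = 7 mod 12 is in neither list. *)
- have [m Mm] : exists m, M = (6 * m)%N by exists (M %/ 6)%N; clear - h; lia.
  have [n Nn] : exists n, N = (2 * n)%N by exists (N %/ 2)%N; clear - hN; lia.
  have mn : (m * n = S ^ 2)%N by rewrite Mm Nn in E; clear - E; lia.
  have := lists m n S mn; rewrite Mm Nn !dvdn_mull //= !inE; lia.
case/or3P=> /eqP h; rewrite h /= in hN.
(* M = 7 mod 12 is in neither list. *)
- have [n Nn] : exists n, N = (12 * n)%N by exists (N %/ 12)%N; clear - hN; lia.
  have mn : (M * n = S ^ 2)%N by rewrite Nn in E; clear - E; lia.
  have := lists M n S mn; rewrite Nn dvdn_mull //= !inE dvdnn; lia.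
(* M = 8 mod 12: as n is odd, the remaining factors 2 move to k, so that M = 8 m
   with m = 1 mod 3, which rules out the opposites of squares; n = 3 mod 4 rules
   out the squares. *)
- have [n Nn] : exists n, N = (6 * n)%N by exists (N %/ 6)%N; clear - hN; lia.
  have n_odd : odd n by clear - hN Nn; lia.
  have [k Mk] : exists k, M = (4 * k)%N by exists (M %/ 4)%N; clear - h; lia.
  have kn : (S ^ 2 = 2 * (k * n))%N by rewrite Mk Nn in E; clear - E; lia.
  have [t St] : exists t, S = (2 * t)%N.
    have : ~~ odd (S ^ 2) by rewrite kn mul2n odd_double.
    by rewrite oddX /= => S_even; exists (S %/ 2)%N; clear - S_even; lia.
  have {}kn : (k * n = 2 * t ^ 2)%N by rewrite St in kn; clear - kn; lia.
  have [m km] : exists m, k = (2 * m)%N.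
    have : ~~ odd (k * n) by rewrite kn mul2n odd_double.
    by rewrite oddM n_odd andbT => k_even; exists (k %/ 2)%N; clear - k_even; lia.
  have mn : (m * n = t ^ 2)%N by rewrite km in kn; clear - kn; lia.
  have := lists m n t mn; rewrite Mk km Nn !dvdn_mull //= n_odd orbT !inE; lia.
(* M = 10 mod 12: m = 2 mod 3 rules out the squares, and n = 1 mod 4 rules out
   their opposites. *)
have [m Mm] : exists m, M = (2 * m)%N by exists (M %/ 2)%N; clear - h; lia.
have [n Nn] : exists n, N = (6 * n)%N by exists (N %/ 6)%N; clear - hN; lia.
have mn : (m * n = S ^ 2)%N by rewrite Mm Nn in E; clear - E; lia.
have := lists m n S mn; rewrite Mm Nn !dvdn_mull //= !inE; lia.
Qed.
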